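(* Let $n$ be any positive integer and let $\lambda$ be any infinite cardinal. Let $\exp_n\lambda=\{A\subseteq\lambda\colon |A|\leqslant n\}$ be the semilattice with operation $\cap$, endowed with any $T_1$-topology making it a semitopological semilattice (i.e. $\cap$ is separately continuous). Then the following conditions are equivalent: (i) $\exp_n\lambda$ is sequentially pracompact; (ii) $\exp_n\lambda$ is totally countably pracompact; (iii) $\exp_n\lambda$ is feebly compact; (iv) $\exp_n\lambda$ is $\mathfrak{D}(\omega)$-compact.
   Context: A semilattice is a commutative semigroup of idempotents. A semitopological semilattice is a topological space together with a separately continuous semilattice operation. For a positive integer $n$ and a non-zero cardinal $\lambda$, $\exp_n\lambda=\{A\subseteq\lambda\colon |A|\leqslant n\}$ with the binary operation $\cap$. A topological space $X$ is: sequentially pracompact if there is a dense subset $D$ of $X$ such that each sequence of points of $D$ has a subsequence convergent in $X$; totally countably pracompact if there is a dense subset $D$ of $X$ such that each sequence of points of $D$ has a subsequence whose closure in $X$ (the closure of its set of terms) is compact; feebly compact if each locally finite open cover of $X$ is finite; $\mathfrak{D}(\omega)$-compact if $f(X)$ is compact for every continuous map $f\colon X\to\mathfrak{D}(\omega)$, where $\mathfrak{D}(\omega)$ is an infinite countable discrete space. ''Compact'' means every open cover has a finite subcover (no Hausdorff assumption). *)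

(* Defs.v *)
From HB Require Import structures.
From mathcomp Require Import all_boot finmap.
From mathcomp Require Import all_classical topology.

Set Implicit Arguments.
Unset Strict Implicit.
Unset Printing Implicit Defensive.

Local Open Scope classical_set_scope.

(* A cardinal lambda is represented by a type L of that cardinality. Since
   classically every type carries a choiceType structure, no cardinal is lost
   by letting L range over the choiceTypes. The subsets of L with at most n
   elements are finite, hence elements of {fset L}. *)
Record exp_sl (n : nat) (L : choiceType) := ExpSl {
  exp_sl_set :> {fset L};
  exp_sl_card : (#|` exp_sl_set| <= n)%N
}.

HB.instance Definition _ (n : nat) (L : choiceType) :=
  [isSub for @exp_sl_set n L].
HB.instance Definition _ (n : nat) (L : choiceType) :=
  [Choice of exp_sl n L by <:].

Lemma exp_sl_cap_card (n : nat) (L : choiceType) (A B : exp_sl n L) :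
  (#|` A `&` B|%fset <= n)%N.
Proof. exact: leq_trans (fsubset_leq_card (fsubsetIl _ _)) (exp_sl_card A). Qed.

Definition exp_sl_cap (n : nat) (L : choiceType) (A B : exp_sl n L) : exp_sl n L :=
  ExpSl (exp_sl_cap_card A B).

(* The library bundles a topology with its carrier; topology and topspace below
   allow one to quantify over all topologies on a given carrier. *)
Record topology (X : choiceType) := Topology {
  topology_open : set (set X);
  topology_openT : topology_open [set: X];
  topology_openI : forall A B,
    topology_open A -> topology_open B -> topology_open (A `&` B);
  topology_open_bigcup : forall (I : Type) (F : I -> set X),
    (forall i, topology_open (F i)) -> topology_open (\bigcup_i F i)
}.

Definition topspace (X : choiceType) (tau : topology X) : Type := X.

HB.instance Definition _ (X : choiceType) (tau : topology X) :=
  Choice.on (topspace tau).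
HB.instance Definition _ (X : choiceType) (tau : topology X) :=
  isOpenTopological.Build (topspace tau) (topology_openT tau)
    (@topology_openI X tau) (@topology_open_bigcup X tau).

Lemma open_topspaceE (X : choiceType) (tau : topology X) :
  (open : set (set (topspace tau))) = topology_open tau.
Proof. by []. Qed.

Definition semilattice_op (S : Type) (op : S -> S -> S) :=
  [/\ associative op, commutative op & idempotent_op op].

Definition separately_continuous (X : topologicalType) (op : X -> X -> X) :=
  forall a : X, continuous (fun x => op a x) /\ continuous (fun x => op x a).

Definition semitopological_semilattice (X : topologicalType)
    (op : X -> X -> X) :=
  semilattice_op op /\ separately_continuous op.

Definition subsequence_index (phi : nat -> nat) :=
  forall i j, (i < j)%N -> (phi i < phi j)%N.

Definition sequentially_pracompact (X : topologicalType) :=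
  exists D : set X, dense D /\
    forall u : nat -> X, (forall k, D (u k)) ->
      exists phi : nat -> nat, subsequence_index phi /\
        exists l : X, (u \o phi) @ \oo --> l.

(* cover_compact is the open-cover form of compactness, with no separation
   axiom. *)
Definition totally_countably_pracompact (X : topologicalType) :=
  exists D : set X, dense D /\
    forall u : nat -> X, (forall k, D (u k)) ->
      exists phi : nat -> nat, subsequence_index phi /\
        cover_compact (closure (range (u \o phi))).

Definition locally_finite (X : topologicalType) (U : set (set X)) :=
  forall x : X, exists2 O : set X, open_nbhs x O &
    finite_set [set V | U V /\ V `&` O !=set0].

Definition feebly_compact (X : topologicalType) :=
  forall U : set (set X),
    (forall V, U V -> open V) -> \bigcup_(V in U) V = [set: X] ->
    locally_finite U -> finite_set U.

(* nat carries the discrete topology in the library. *)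
Definition Domega_compact (X : topologicalType) :=
  forall f : X -> nat, continuous f -> cover_compact (range f).

(* Main.v *)
(** The only implication specific to exp_n L is that D(omega)-compactness
    implies sequential pracompactness. Every principal filter is clopen, being
    the preimage of a point of a finite, hence discrete, subspace under a
    translation; so the space is Hausdorff, and its isolated points are dense.
    Given a sequence of isolated points u k, choose R of maximal cardinality
    among the sets contained in u k for infinitely many k, and keep these k.
    No point other than R is an accumulation point of the resulting subsequence.
    If infinitely many of its terms avoided a neighbourhood of R, they would
    form an infinite closed set E of isolated points, and a map sending
    infinitely many points of E to distinct nonzero integers and everything
    else to 0 would be continuous with infinite range. *)

Require Import Defs.
From mathcomp Require Import all_boot finmap.
From mathcomp Require Import all_classical topology.

Set Implicit Arguments.
Unset Strict Implicit.
Unset Printing Implicit Defensive.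

Local Open Scope classical_set_scope.

(** * Infinite sets, subsequences and injective enumerations *)

Lemma infinite_set_nat_ge (S : set nat) (N : nat) :
  infinite_set S -> exists2 k, (N <= k)%N & S k.
Proof.
move=> /infinite_setD/(_ (finite_II N))/infinite_setN0[k [Sk /= /negP]].
by rewrite -leqNgt => Nk; exists k.
Qed.

Lemma infinite_set_subsequence (S : set nat) : infinite_set S ->
  exists2 phi, subsequence_index phi & forall k, S (phi k).
Proof.
move=> Soo.
have /choice[next nextP] : forall N, exists k, (N <= k)%N /\ S k.
  by move=> N; have [k] := infinite_set_nat_ge N Soo; exists k.
pose phi := fix phi k := if k is k'.+1 then next (phi k').+1 else next 0.
exists phi; last by case=> [|k]; apply: (nextP _).2.
move=> i; elim=> // j IHj; rewrite ltnS leq_eqVlt => /predU1P[->|/IHj].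
  exact: (nextP _).1.
by move=> /ltn_trans; apply; exact: (nextP _).1.
Qed.

Lemma subsequence_index_inj (phi : nat -> nat) :
  subsequence_index phi -> injective phi.
Proof.
move=> phiP i j eq_phi.
by case: (ltngtP i j) => // /phiP; rewrite eq_phi ltnn.
Qed.

Lemma infinite_set_inj (T : Type) (A : set T) : infinite_set A ->
  exists2 g : nat -> T, injective g & forall k, A (g k).
Proof.
elim/Ppointed: T => T in A *; first by rewrite emptyE => /(_ (finite_set0 _)).
move=> /infiniteP/pcard_leP/unsquash f.
exists f => [i j|k]; last exact: 'funS_f.
by apply: 'inj_f; rewrite in_setE.
Qed.

Lemma infinite_set_range_inj (T : Type) (g : nat -> T) :
  injective g -> infinite_set (range g).
Proof.
move=> g_inj /(finite_preimage (in2W g_inj)).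
have -> : g @^-1` range g = setT by apply/seteqP; split=> // k _; exists k.
by apply/infiniteP; exact: card_lexx.
Qed.

(** * Implications between compactness properties of general topological spaces *)

Section Topology.
Variable X : topologicalType.

(** In a Hausdorff space the closure adds at most [l] to the terms; a member of the cover around [l]
    takes all but finitely many terms. *)
Lemma cvg_cover_compact_closure_range (v : nat -> X) (l : X) :
  hausdorff_space X -> v @ \oo --> l -> cover_compact (closure (range v)).
Proof.
move=> X_T2 v_l; have X_T1 := hausdorff_accessible X_T2.
have clv p : closure (range v) p -> p = l \/ exists k, v k = p.
  move=> clp; apply/or_asboolP; apply/contraT; rewrite negb_or => /andP[].
  move=> /asboolP pl /asboolP vp; exfalso; apply: pl; apply/esym.
  apply: X_T2 => A B /v_l[N _ vA] Bp.
  have C_closed : closed (v @` `I_N).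
    by apply: (accessible_finite_set_closed.1 X_T1); exact: finite_image.
  (* Deleting the first [N] terms from [B] forces the term found near [p] to have index at least
     [N], hence to lie in [A] too. *)
  have : nbhs p (B `&` ~` (v @` `I_N)).
    apply: filterI => //; apply: open_nbhs_nbhs; split; first exact: closed_openC.
    by move=> [k _ vk]; apply: vp; exists k.
  move=> /clp[_ [[k _ <-] [Bk vkN]]]; exists (v k); split => //.
  by apply: vA => /=; rewrite leqNgt; apply/negP => kN; apply: vkN; exists k.
move=> I D f f_open clvD.
have /clvD[i0 Di0 fi0] : closure (range v) l.
  by move=> B /v_l[N _ /(_ N (leqnn N)) BN]; exists (v N); split=> //; exists N.
have [N _ vN] : \forall k \near \oo, f i0 (v k).
  by apply: v_l; apply: open_nbhs_nbhs; split => //; exact: f_open.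
have /choice[idx idxP] : forall k, exists i, D i /\ f i (v k).
  move=> k; have /clvD[i Di fi] : closure (range v) (v k); last by exists i.
  by apply: subset_closure; exists k.
exists (i0 |` [fset idx k | k in iota 0 N])%fset => [i|p].
  by rewrite !inE => /orP[/eqP->//|/imfsetP[k _ ->]]; have [] := idxP k.
move=> /clv[->|[k <-]]; first by exists i0 => //=; rewrite !inE eqxx.
have [Nk|kN] := leqP N k; first by exists i0; [rewrite /= !inE eqxx|exact: vN].
exists (idx k); last exact: (idxP k).2.
by rewrite /= !inE; apply/orP; right; apply/imfsetP; exists k; rewrite ?mem_iota.
Qed.

Lemma sequentially_pracompact_totally : hausdorff_space X ->
  sequentially_pracompact X -> totally_countably_pracompact X.
Proof.
move=> X_T2 [D [D_dense DP]]; exists D; split=> // u /DP[phi [phiP [l ul]]].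
by exists phi; split=> //; exact: cvg_cover_compact_closure_range ul.
Qed.

(** Choose points of [D] in infinitely many distinct members of [U]. Finitely many neighbourhoods,
    each meeting finitely many members, would cover the compact closure of a subsequence, which
    meets infinitely many. *)
Lemma totally_countably_pracompact_feebly :
  totally_countably_pracompact X -> feebly_compact X.
Proof.
move=> [D [D_dense DP]] U U_open _ U_lf; apply: contrapT => Uoo.
(* The empty set is discarded because density yields points only in nonempty open sets. *)
have [g g_inj Ug] := infinite_set_inj (infinite_setD Uoo (finite_set1 set0)).
have /choice[d dP] : forall k, exists x, g k x /\ D x.
  move=> k; have [Ugk gk0] := Ug k.
  have /D_dense : g k !=set0 by apply/set0P/eqP => gk; apply: gk0.
  by move=> /(_ (U_open _ Ugk)) [x [? ?]]; exists x.
have [phi [phiP dK]] := DP d (fun k => (dP k).2).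
have /choice[O OP] : forall x, exists O,
    open_nbhs x O /\ finite_set [set V | U V /\ V `&` O !=set0].
  by move=> x; have [O ? ?] := U_lf x; exists O.
have [x _|x _|E _ KE] := dK {classic X} setT O.
- exact: (OP x).1.1.
- by exists x => //; exact: (OP x).1.2.
have : finite_set (\bigcup_(x in [set` E]) [set V | U V /\ V `&` O x !=set0]).
  by apply: bigcup_finite => // x _; exact: (OP x).2.
have gphi_inj : injective (g \o phi).
  by move=> i j /g_inj; exact: subsequence_index_inj.
have := infinite_set_range_inj gphi_inj.
apply: sub_infinite_set => _ [k _ <-] /=.
have /KE[x Ex Ox] : closure (range (d \o phi)) (d (phi k)).
  by apply: subset_closure; exists k.
exists x => //; split; first exact: (Ug _).1.
by exists (d (phi k)); split=> //; exact: (dP _).1.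
Qed.

Lemma cover_compact_nat_finite (A : set nat) : cover_compact A -> finite_set A.
Proof.
move=> /(_ nat setT (fun k => [set k]))[k _|k Ak|E _ AE].
- exact: discrete_open.
- by exists k.
apply: sub_finite_set (finite_fset E) => k /AE[j Ej ->].
exact: Ej.
Qed.

Lemma feebly_Domega_compact : feebly_compact X -> Domega_compact X.
Proof.
move=> X_fc f f_cont; rewrite -compact_cover; apply: finite_compact.
have fibre_open k : open (f @^-1` [set k]).
  by apply: open_comp => [x _|]; [exact: f_cont|exact: discrete_open].
pose F k := f @^-1` [set k].
(* Values outside the range all share the empty fibre, so injectivity is claimed only for nonempty
   fibres. *)
have F_inj : {in F @^-1` (F @` range f) &, injective F}.
  move=> k k'; rewrite !in_setE => -[_ [x _ <-]] Fk _ Fkk'.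
  have kx : F k x by rewrite -Fk.
  by have k'x : F k' x; [rewrite -Fkk'|rewrite -[k]kx -[k']k'x].
suff /(finite_preimage F_inj) : finite_set (F @` range f).
  by apply: sub_finite_set => k; exists k.
apply: X_fc => [_ [k _ <-]||x]; first exact: fibre_open.
  apply/seteqP; split=> // x _; exists (F (f x)) => //.
  by exists (f x) => //; exists x.
exists (F (f x)); first by split=> //; exact: fibre_open.
apply: sub_finite_set (finite_set1 (F (f x))).
by move=> _ [[k _ <-] [y [<- <-]]].
Qed.

(** Every subset of [E] is clopen: it is a union of isolated points, and its complement is the open
    complement of [E] plus such a union. *)
Lemma closed_isolated_finite (E : set X) :
  Domega_compact X -> closed E -> (forall x, E x -> open [set x]) ->
  finite_set E.
Proof.
move=> X_Dc E_closed E_iso; apply: contrapT => Eoo.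
have [g g_inj Eg] := infinite_set_inj Eoo.
have sub_open B : B `<=` E -> open B.
  move=> BE; have -> : B = \bigcup_(x in B) [set x].
    by apply/seteqP; split=> [x Bx|_ [x Bx ->//]]; exists x.
  by apply: bigcup_open => x /BE; exact: E_iso.
have sub_closed B : B `<=` E -> closed B.
  move=> BE; rewrite -openC; have -> : ~` B = ~` E `|` (E `\` B).
    apply/seteqP; split=> [x Bx|x [/[swap]/BE//|[]//]].
    by have [Ex|] := pselect (E x); [right|left].
  by apply: openU; [exact: closed_openC|apply: sub_open => x []].
have /choice[f fP] : forall x, exists m,
    (range g x -> exists2 k, g k = x & m = k.+1) /\ (~ range g x -> m = 0).
  move=> x; have [[k _ gk]|gx] := pselect (range g x); last by exists 0.
  by exists k.+1; split=> [_|[]]; exists k.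
have fE x : f x <> 0 -> E x.
  move=> fx; have [[k _ <-//]|gx] := pselect (range g x).
  by have := (fP x).2 gx.
(* Off [E] the value is 0, so either the preimage of [A] or its complement lies inside [E]. *)
have f_cont : continuous f.
  apply/continuousP => A _; have [A0|A0] := pselect (A 0); last first.
    by apply: sub_open => x Afx; apply: fE => fx; apply: A0; rewrite -fx.
  rewrite -closedC; apply: sub_closed => x Afx; apply: fE => fx.
  by apply: Afx; rewrite /= fx.
have := cover_compact_nat_finite (X_Dc f f_cont).
apply: sub_infinite_set (infinite_set_range_inj succn_inj) => _ [k _ <-].
exists (g k) => //; have [|j /g_inj -> //] := (fP (g k)).1.
by exists k.
Qed.
End Topology.

(** * The semilattice of small subsets under a T1 semitopological topology *)

Section ExpSemilattice.
Variables (n : nat) (L : choiceType) (tau : topology (exp_sl n L)).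
Hypothesis tau_T1 : accessible_space (topspace tau).
Hypothesis tau_semitop :
  @semitopological_semilattice (topspace tau) (@exp_sl_cap n L).

Local Notation X := (topspace tau).

Definition up_set (A : exp_sl n L) : set X :=
  [set B : exp_sl n L | (A `<=` B)%fset].

Lemma up_setE (A : exp_sl n L) :
  up_set A = (fun B : X => exp_sl_cap A B) @^-1` [set (A : X)].
Proof.
apply/seteqP; split=> B /=.
  by move=> /fsetIidPl AB; exact: val_inj.
by move=> /(congr1 val)/fsetIidPl.
Qed.

Lemma up_set_closed (A : exp_sl n L) : closed (up_set A).
Proof.
rewrite up_setE; have /continuous_closedP := (tau_semitop.2 A).1; apply.
exact: accessible_closed_set1.
Qed.

(* The principal ideal of [A] is finite, hence discrete in a T1 topology. *)
Lemma up_set_open (A : exp_sl n L) : open (up_set A).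
Proof.
pose C : set X := [set B : exp_sl n L | (B `<=` A)%fset] `\` [set A].
have C_closed : closed C.
  apply: (accessible_finite_set_closed.1 tau_T1); apply: finite_setD.
  have -> : [set B : exp_sl n L | (B `<=` A)%fset]
      = @exp_sl_set n L @^-1` [set` fpowerset A].
    by apply/seteqP; split=> B /=; rewrite fpowersetE.
  by apply: finite_preimage => // B B' _ _; exact: val_inj.
have -> : up_set A = (fun B : X => exp_sl_cap A B) @^-1` (~` C).
  rewrite up_setE; apply/seteqP; split=> B /=.
    by move=> -> [_]; exact.
  move=> nC; apply: contrapT => nA; apply: nC; split=> //; exact: fsubsetIl.
have /continuousP := (tau_semitop.2 A).1; apply.
exact: closed_openC.
Qed.

(** If [A] is not contained in [B], the clopen set [up_set A] separates them; antisymmetry of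
    inclusion does the rest. *)
Lemma exp_sl_hausdorff : hausdorff_space X.
Proof.
suff sep (A B : X) : cluster (nbhs A) B -> ((A : exp_sl n L) `<=` B)%fset.
  move=> A B AB; apply/val_inj/eqP; rewrite eqEfsubset !sep//.
  by move=> U V BU AV; rewrite setIC; exact: AB.
move=> AB; apply: contrapT => nAB.
have [||C []//] := AB (up_set A) (~` up_set A).
  by apply: open_nbhs_nbhs; split; [exact: up_set_open|exact: fsubset_refl].
by apply: open_nbhs_nbhs; split=> //; apply: closed_openC; exact: up_set_closed.
Qed.

(* An element of maximal cardinality in an open set is isolated. *)
Lemma isolated_dense : dense [set A : X | open [set A]].
Proof.
move=> O [A0 OA0] O_open.
pose P m := `[< exists2 A : exp_sl n L, O A & #|` A| = m >].
have exP : exists m, P m by exists #|` (A0 : exp_sl n L)|; apply/asboolP; exists A0.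
have [m /asboolP[A OA mA] Amax] : exists2 m, P m & forall m', P m' -> (m' <= m)%N.
  have bP m : P m -> (m <= n)%N by move=> /asboolP[A _ <-]; exact: exp_sl_card.
  by case: (ex_maxnP exP bP) => m; exists m.
exists A; split=> //=.
have -> : [set A : X] = O `&` up_set A.
  apply/seteqP; split=> [_ ->|B [OB AB]]; first by split=> //; exact: fsubset_refl.
  apply/esym/val_inj/eqP; rewrite eqEfcard AB/= mA; apply: Amax.
  by apply/asboolP; exists B.
by apply: openI => //; exact: up_set_open.
Qed.

(** The empty set is a candidate and [n] bounds the cardinalities, so a largest [R] exists; then the
    candidate [R] united with [P] cannot exceed [R]. *)
Lemma max_infinitely_often_subset (u : nat -> exp_sl n L) :
  exists2 R : exp_sl n L, infinite_set [set k | R `<=` u k]%fset &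
    forall P : exp_sl n L,
      infinite_set [set k | (R `<=` u k) && (P `<=` u k)]%fset -> (P `<=` R)%fset.
Proof.
pose Q m := `[< exists2 R : {fset L},
  infinite_set [set k | R `<=` u k]%fset & #|` R| = m >].
have exQ : exists m, Q m.
  exists 0; apply/asboolP; exists fset0; rewrite ?cardfs0//.
  have -> : [set k | fset0 `<=` u k]%fset = setT.
    by apply/seteqP; split=> // k _; exact: fsub0set.
  by apply/infiniteP; exact: card_lexx.
have card_le (R : {fset L}) : infinite_set [set k | R `<=` u k]%fset -> (#|` R| <= n)%N.
  move=> /infinite_setN0[k] /= /fsubset_leq_card/leq_trans; apply.
  exact: exp_sl_card.
have bQ m : Q m -> (m <= n)%N by move=> /asboolP[R /card_le + <-].
case: (ex_maxnP exQ bQ) => _ /asboolP[R Roo <-] Rmax.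
exists (ExpSl (card_le R Roo)) => //= P Poo.
have RPoo : infinite_set [set k | R `|` P `<=` u k]%fset.
  by apply: sub_infinite_set Poo => k /=; rewrite fsubUset.
have /eqP -> : R == (R `|` P)%fset.
  rewrite eqEfcard fsubsetUl/=; apply: Rmax; apply/asboolP.
  by exists (R `|` P)%fset.
exact: fsubsetUr.
Qed.

Lemma Domega_sequentially_pracompact :
  Domega_compact X -> sequentially_pracompact X.
Proof.
move=> X_Dc; exists [set A : X | open [set A]]; split; first exact: isolated_dense.
move=> u u_iso; have [R Roo Rmax] := max_infinitely_often_subset u.
have [phi phiP Rphi] := infinite_set_subsequence Roo.
exists phi; split=> //; exists (R : X) => W; rewrite nbhsE => -[U [U_open UR] UW].
suff : finite_set [set k | ~ U (u (phi k))].
  move=> Ufin; pose N := (\max_(k <- fset_set [set k | ~ U (u (phi k))]) k).+1.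
  exists N => // k Nk; apply: UW; apply: contrapT => Uk.
  move: Nk; rewrite /N/= ltnNge => /negP; apply.
  by apply: leq_bigmax_seq => //; rewrite in_fset_set// in_setE.
apply: contrapT => Too; set T := [set k | _] in Too.
pose E : set X := (u \o phi) @` T.
have finite_above (P : exp_sl n L) : ~ (P `<=` R)%fset ->
    finite_set (T `&` [set k | P `<=` u (phi k)]%fset).
  move=> PR; apply: contrapT => PToo; apply: PR; apply: Rmax.
  have : infinite_set (phi @` (T `&` [set k | P `<=` u (phi k)]%fset)).
    move=> /(finite_preimage (in2W (subsequence_index_inj phiP))).
    by apply: sub_infinite_set PToo => k; exists k.
  apply: sub_infinite_set => _ [k [_ /= Pk] <-] /=.
  by rewrite Pk andbT; exact: Rphi.
have above_notsub (P : exp_sl n L) :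
    (R `<=` P)%fset -> P <> R -> ~ (P `<=` R)%fset.
  by move=> RP PR ?; apply/PR/val_inj/eqP; rewrite eqEfsubset; apply/andP.
have E_closed : closed E.
  rewrite -openC openE => P EP; rewrite /interior nbhsE.
  (* Three cases: at [R], the set [U] misses [E]; if [P] does not contain [R], the complement of
     [up_set R] does; if [P] strictly contains [R], [up_set P] meets [E] in a finite set, which is
     removed. *)
  have [->|/eqP PR] := eqVneq P (R : X).
    by exists U => // _ /[swap] -[k Tk <-].
  have [RP|RP] := boolP ((R : exp_sl n L) `<=` P)%fset; last first.
    exists (~` up_set R).
      by split; [apply: closed_openC; exact: up_set_closed|exact/negP].
    by move=> _ /[swap] -[k Tk <-] /=; apply; exact: Rphi.
  exists (up_set P `&` ~` (E `&` up_set P)); last by move=> B [PB nEB] EB; exact: nEB.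
  split; last by split; [exact: fsubset_refl|case].
  apply: openI; first exact: up_set_open.
  apply: closed_openC; apply: (accessible_finite_set_closed.1 tau_T1).
  have := finite_image (u \o phi) (finite_above P (above_notsub P RP PR)).
  by apply: sub_finite_set => _ [[k Tk <-] Pk]; exists k.
have E_fin : finite_set E.
  by apply: closed_isolated_finite => // _ [k _ <-]; exact: u_iso.
(* Terms may repeat, so finiteness of [E] does not yet bound [T]; but each point of [E] strictly
   contains [R], hence occurs at finitely many indices. *)
have : finite_set (\bigcup_(B in E) (T `&` [set k | (B : exp_sl n L) `<=` u (phi k)]%fset)).
  apply: bigcup_finite => // _ [k Tk <-]; apply/finite_above/above_notsub => /=.
    exact: Rphi.
  by move=> uR; apply: Tk; rewrite uR.
apply: sub_infinite_set Too => k Tk; exists (u (phi k)); first by exists k.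
by split=> //; exact: fsubset_refl.
Qed.
End ExpSemilattice.

Theorem theorem1 (n : nat) (L : choiceType) (tau : topology (exp_sl n L))
    (n_gt0 : (0 < n)%N)
    (L_infinite : infinite_set [set: L]%classic)
    (tau_T1 : accessible_space (topspace tau))
    (tau_semitop :
      @semitopological_semilattice (topspace tau) (@exp_sl_cap n L)) :
  [<-> sequentially_pracompact (topspace tau);
       totally_countably_pracompact (topspace tau);
       feebly_compact (topspace tau);
       Domega_compact (topspace tau)].
Proof.
have X_T2 := exp_sl_hausdorff tau_T1 tau_semitop.
tfae.
- exact: sequentially_pracompact_totally.
- exact: totally_countably_pracompact_feebly.
- exact: feebly_Domega_compact.
- exact: Domega_sequentially_pracompact.
Qed.
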